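(* Let $k<n$ be natural numbers. The graph $T_{n,k}=K_k\lor\overline{K_{n-k}}$ is completely positive if and only if $k\le 2$.
   Context: All graphs are finite, simple and undirected; natural numbers are positive. $K_m$ is the complete graph on $m$ vertices, $\overline{K_m}$ is the empty graph (no edges) on $m$ vertices, and the join $G_1\lor G_2$ is obtained from the disjoint union of $G_1$ and $G_2$ by connecting every vertex of $G_1$ to every vertex of $G_2$. A real matrix $A$ is completely positive if there exists an (entrywise) nonnegative, not necessarily square, matrix $B$ with $A=BB^{T}$. A real symmetric matrix is doubly nonnegative if it is entrywise nonnegative and positive semidefinite. The graph $G(A)$ of a real symmetric $n\times n$ matrix $A=(a_{i,j})$ has vertex set $\{1,\dots,n\}$ and edges $(i,j)$ for $i\ne j$ with $a_{i,j}\ne 0$; $A$ is a matrix realization of $G$ if $G(A)=G$. A graph $G$ is completely positive (CP) if every doubly nonnegative matrix realization of $G$ is completely positive.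
   Formalization: The pair n = 4, k = 3 is excluded, since the claim fails there: T_{4,3} is the complete graph on 4 vertices, which is completely positive because every doubly nonnegative matrix of order at most 4 is completely positive. *)

(* Defs.v *)
From HB Require Import structures.
From mathcomp Require Import all_boot all_order all_algebra.
From mathcomp Require Import reals.

Set Implicit Arguments.
Unset Strict Implicit.
Unset Printing Implicit Defensive.

Import Order.TTheory GRing.Theory Num.Theory.
Local Open Scope ring_scope.

Record sgraph := SGraph {
  vertex : finType;
  edge : rel vertex;
  edge_sym : symmetric edge;
  edge_irr : irreflexive edge }.

Definition graph_iso (G H : sgraph) : Prop :=
  exists2 f : vertex G -> vertex H,
    bijective f & forall x y, edge (f x) (f y) = edge x y.

Section BasicGraphs.

Variable m : nat.

Definition complete_rel : rel 'I_m := fun i j => i != j.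

Lemma complete_sym : symmetric complete_rel.
Proof. by move=> i j; rewrite /complete_rel eq_sym. Qed.

Lemma complete_irr : irreflexive complete_rel.
Proof. by move=> i; rewrite /complete_rel eqxx. Qed.

Definition complete_graph := SGraph complete_sym complete_irr.

Definition empty_rel : rel 'I_m := fun _ _ => false.

Lemma empty_sym : symmetric empty_rel. Proof. by []. Qed.

Lemma empty_irr : irreflexive empty_rel. Proof. by []. Qed.

Definition empty_graph := SGraph empty_sym empty_irr.

End BasicGraphs.

Section Join.

Variables G1 G2 : sgraph.

Definition join_rel : rel (vertex G1 + vertex G2)%type := fun u v =>
  match u, v with
  | inl x, inl y => edge x y
  | inr x, inr y => edge x y
  | _, _ => true
  end.

Lemma join_sym : symmetric join_rel.
Proof. by move=> [x|x] [y|y] //=; apply: edge_sym. Qed.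

Lemma join_irr : irreflexive join_rel.
Proof. by move=> [x|x] /=; apply: edge_irr. Qed.

Definition join_graph := SGraph join_sym join_irr.

End Join.

(* The subtraction is truncated, so this is only meant for k <= n. *)
Definition T_graph (n k : nat) : sgraph :=
  join_graph (complete_graph k) (empty_graph (n - k)).

Section MatrixGraph.

Variables (R : realType) (n : nat) (A : 'M[R]_n).

Definition mx_rel : rel 'I_n := fun i j => (i != j) && (A i j != 0).

Hypothesis symA : A^T = A.

Lemma mx_rel_sym : symmetric mx_rel.
Proof. by move=> i j; rewrite /mx_rel eq_sym -{1}symA mxE. Qed.

Lemma mx_rel_irr : irreflexive mx_rel.
Proof. by move=> i; rewrite /mx_rel eqxx. Qed.

Definition mx_graph := SGraph mx_rel_sym mx_rel_irr.

End MatrixGraph.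

Section Matrices.

Variable R : realType.

Definition nonneg_mx m n (A : 'M[R]_(m, n)) : Prop := forall i j, 0 <= A i j.

Definition psd_mx n (A : 'M[R]_n) : Prop :=
  A^T = A /\ forall x : 'cV[R]_n, 0 <= (x^T *m A *m x) 0 0.

Definition doubly_nonnegative n (A : 'M[R]_n) : Prop :=
  nonneg_mx A /\ psd_mx A.

Definition completely_positive n (A : 'M[R]_n) : Prop :=
  exists (m : nat) (B : 'M[R]_(n, m)), nonneg_mx B /\ A = B *m B^T.

(* The vertices of G need not be the indices of A, so "G(A) = G" is read up to
   a labelling of the vertices of G by these indices. *)
Definition realization (G : sgraph) n (A : 'M[R]_n) : Prop :=
  exists symA : A^T = A, graph_iso (mx_graph symA) G.

Definition CP_graph (G : sgraph) : Prop :=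
  forall (n : nat) (A : 'M[R]_n),
    realization G A -> doubly_nonnegative A -> completely_positive A.

End Matrices.

(* Main.v *)
Require Import Defs.
From mathcomp Require Import all_boot all_order all_algebra.
From mathcomp Require Import reals.
From mathcomp Require Import ring lra.

Set Implicit Arguments.
Unset Strict Implicit.
Unset Printing Implicit Defensive.

Import Order.TTheory GRing.Theory Num.Theory.

(* For k >= 3, excluding (n, k) = (4, 3), the graph contains a 5-cycle.  A
   doubly nonnegative matrix that is large on the edges of this cycle, plus a
   small perturbation with the pattern of the whole graph, has negative inner
   product with the copositive Horn matrix of the cycle, so it is not
   completely positive.

   For k <= 2 choose two vertices a, b such that all other vertices (leaves)
   are pairwise nonadjacent, and let S be the 2 x 2 Schur complement obtained
   by eliminating the leaves.  If S is nonnegative, A is the sum of S and of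
   nonnegative rank one matrices, one for each leaf.  Otherwise, with
   c_j = A_aj A_bj / A_jj, distribute S over the leaves j with weights
   c_j / sum c: each leaf then carries a matrix of order 3 that is still doubly
   nonnegative, hence completely positive. *)

(** * Complete positivity for spans of at most three nonnegative vectors *)

Section CompletelyPositiveCone.
Local Open Scope ring_scope.

Variables (R : realType) (n : nat).
Implicit Types (A B : 'M[R]_n) (u v w : 'cV[R]_n).

Lemma outerE u v i j : (u *m v^T) i j = u i 0 * v j 0.
Proof. by rewrite mxE big_ord1 mxE. Qed.

Lemma cp0 : completely_positive (0 : 'M[R]_n).
Proof.
exists 0%N, 0; split; first by move=> i [].
by apply/matrixP => i j; rewrite !mxE big_ord0.
Qed.

Lemma cpD A B : completely_positive A -> completely_positive B ->
  completely_positive (A + B).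
Proof.
move=> [p [U [U0 ->]]] [q [V [V0 ->]]]; exists (p + q)%N, (row_mx U V); split.
  by move=> i j; rewrite mxE; case: split => k.
by rewrite tr_row_mx mul_row_col.
Qed.

Lemma cp_sum (I : Type) (r : seq I) (P : pred I) (F : I -> 'M[R]_n) :
  (forall i, P i -> completely_positive (F i)) ->
  completely_positive (\sum_(i <- r | P i) F i).
Proof. by move=> FP; elim/big_ind: _ => //; [exact: cp0|exact: cpD]. Qed.

Lemma cp_outer (c : R) u : 0 <= c -> nonneg_mx u ->
  completely_positive (c *: (u *m u^T)).
Proof.
move=> c0 u0; exists 1%N, (Num.sqrt c *: u); split.
  by move=> i j; rewrite mxE mulr_ge0 ?sqrtr_ge0.
apply/matrixP => i j; rewrite mxE !outerE !mxE.
by rewrite -{1}(sqr_sqrtr c0); ring.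
Qed.

(** Completing the square with pivot [p] leaves [r - q^2/p] on [v]; if [p = 0], the determinant
    bound forces [q = 0]. *)
Lemma cp_order2 (p q r : R) u v : nonneg_mx u -> nonneg_mx v ->
  0 <= p -> 0 <= q -> 0 <= r -> q ^+ 2 <= p * r ->
  completely_positive (p *: (u *m u^T) + q *: (u *m v^T + v *m u^T)
                       + r *: (v *m v^T)).
Proof.
move=> u0 v0 p0 q0 r0 qpr; have [p1|p1] := eqVneq p 0.
  have -> : q = 0.
    by apply/eqP; rewrite -sqrf_eq0 eq_le sqr_ge0 andbT (le_trans qpr) ?p1 ?mul0r.
  rewrite p1 !scale0r !add0r; exact: cp_outer.
have pp : 0 < p by rewrite lt_def p1.
have -> : p *: (u *m u^T) + q *: (u *m v^T + v *m u^T) + r *: (v *m v^T) =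
  p^-1 *: ((p *: u + q *: v) *m (p *: u + q *: v)^T)
  + (r - q ^+ 2 / p) *: (v *m v^T).
  by apply/matrixP => i j; rewrite !(outerE, mxE); field.
apply: cpD; apply: cp_outer => //.
- by rewrite invr_ge0.
- by move=> i j; rewrite !mxE addr_ge0 ?mulr_ge0.
- by rewrite subr_ge0 ler_pdivrMr // mulrC.
Qed.

(* U M U^T for U = [u v w] and M = [[a, b, c], [b, d, e], [c, e, f]]. *)
Definition span3 (a d f b c e : R) u v w : 'M[R]_n :=
  a *: (u *m u^T) + d *: (v *m v^T) + f *: (w *m w^T)
  + b *: (u *m v^T + v *m u^T) + c *: (u *m w^T + w *m u^T)
  + e *: (v *m w^T + w *m v^T).

Lemma span3E a d f b c e u v w i j : span3 a d f b c e u v w i j =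
  a * (u i 0 * u j 0) + d * (v i 0 * v j 0) + f * (w i 0 * w j 0)
  + b * (u i 0 * v j 0 + v i 0 * u j 0) + c * (u i 0 * w j 0 + w i 0 * u j 0)
  + e * (v i 0 * w j 0 + w i 0 * v j 0).
Proof. by rewrite /span3 !(outerE, mxE). Qed.

(** Eliminating the third index splits off the rank one term of [x]. The remaining 2 x 2 Schur
    complement is entrywise nonnegative, and its determinant is the 3 x 3 determinant over [f], so
    order 2 applies. *)
Lemma cp_pivot3 (a d f b c e : R) u v w :
  nonneg_mx u -> nonneg_mx v -> nonneg_mx w -> 0 < f -> 0 <= c -> 0 <= e ->
  c ^+ 2 <= a * f -> e ^+ 2 <= d * f -> c * e <= b * f ->
  0 <= a * d * f + 2 * b * c * e - a * e ^+ 2 - d * c ^+ 2 - f * b ^+ 2 ->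
  completely_positive (span3 a d f b c e u v w).
Proof.
move=> u0 v0 w0 f0 c0 e0 caf edf cebf det0; have fn : f != 0 by rewrite gt_eqF.
pose x := c *: u + e *: v + f *: w.
have -> : span3 a d f b c e u v w = f^-1 *: (x *m x^T) +
  ((a - c ^+ 2 / f) *: (u *m u^T) + (b - c * e / f) *: (u *m v^T + v *m u^T)
   + (d - e ^+ 2 / f) *: (v *m v^T)).
  apply/matrixP => i j; rewrite span3E; rewrite !(outerE, mxE).
  by field.
apply: cpD; first apply: cp_outer.
- by rewrite invr_ge0 ltW.
- by move=> i j; rewrite !mxE !addr_ge0 ?mulr_ge0 // ltW.
apply: cp_order2; rewrite ?subr_ge0 ?ler_pdivrMr // -subr_ge0.
have -> : (a - c ^+ 2 / f) * (d - e ^+ 2 / f) - (b - c * e / f) ^+ 2 =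
  (a * d * f + 2 * b * c * e - a * e ^+ 2 - d * c ^+ 2 - f * b ^+ 2) / f by field.
by rewrite divr_ge0 // ltW.
Qed.

(* Unless f = 0, the Schur complement at the third or at the second index is
   nonnegative: b f < c e and c d < b e together give d f < e^2. *)
Lemma cp_order3 (a d f b c e : R) u v w :
  nonneg_mx u -> nonneg_mx v -> nonneg_mx w ->
  0 <= a -> 0 <= d -> 0 <= f -> 0 <= b -> 0 <= c -> 0 <= e ->
  b ^+ 2 <= a * d -> c ^+ 2 <= a * f -> e ^+ 2 <= d * f ->
  0 <= a * d * f + 2 * b * c * e - a * e ^+ 2 - d * c ^+ 2 - f * b ^+ 2 ->
  completely_positive (span3 a d f b c e u v w).
Proof.
move=> u0 v0 w0 a0 d0 f0 b0 c0 e0 bad caf edf det0.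
have [f1|f1] := eqVneq f 0.
  have sq0 (x y : R) : x ^+ 2 <= y * f -> x = 0.
    by rewrite f1 mulr0 => x0; apply/eqP; rewrite -sqrf_eq0 eq_le sqr_ge0 andbT.
  rewrite (sq0 _ _ caf) (sq0 _ _ edf) f1 /span3 !scale0r !addr0.
  by rewrite addrAC; exact: cp_order2.
have fp : 0 < f by rewrite lt_def f1.
have [cebf|bfce] := leP (c * e) (b * f); first exact: cp_pivot3.
have bf0 : 0 <= b * f by rewrite mulr_ge0.
have ep : 0 < e.
  by rewrite lt_def e0 andbT; apply: contraTneq bfce => ->; rewrite mulr0 -leNgt.
have cp : 0 < c.
  by rewrite lt_def c0 andbT; apply: contraTneq bfce => ->; rewrite mul0r -leNgt.
have dp : 0 < d.
  have := lt_le_trans (exprn_gt0 2 ep) edf.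
  by rewrite pmulr_lgt0.
have [becd|cdbe] := leP (b * e) (c * d).
  have -> : span3 a d f b c e u v w = span3 a f d c b e u w v.
    by apply/matrixP => i j; rewrite !span3E; ring.
  by apply: cp_pivot3 => //; [rewrite mulrC|lra].
have bp : 0 < b.
  rewrite lt_def b0 andbT; apply: contraTneq cdbe => ->.
  by rewrite mul0r -leNgt mulr_ge0.
have: (b * f) * (c * d) < (c * e) * (b * e).
  by apply: ltr_pM; rewrite ?mulr_ge0.
have -> : (b * f) * (c * d) = (b * c) * (d * f) by ring.
have -> : (c * e) * (b * e) = (b * c) * e ^+ 2 by ring.
by rewrite ltr_pM2l ?mulr_gt0 // ltNge edf.
Qed.

End CompletelyPositiveCone.

(** * Matrices whose indices outside two hubs are pairwise nonadjacent *)

Section TwoHubs.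
Local Open Scope ring_scope.

Variables (R : realType) (n : nat).
Implicit Types (A : 'M[R]_n) (u v w x : 'cV[R]_n).

(** The terms in [a], [d], [b] do not involve [w]: what the leaves carry on the hub block adds up to
    one matrix. *)
Lemma span3_sum (I : Type) (r : seq I) (P : pred I)
    (a d f b c e : I -> R) u v (w : I -> 'cV[R]_n) :
  \sum_(i <- r | P i) span3 (a i) (d i) (f i) (b i) (c i) (e i) u v (w i) =
  span3 (\sum_(i <- r | P i) a i) (\sum_(i <- r | P i) d i) 0
        (\sum_(i <- r | P i) b i) 0 0 u v 0
  + \sum_(i <- r | P i) span3 0 0 (f i) 0 (c i) (e i) u v (w i).
Proof.
rewrite /span3 !scale0r !addr0 !scaler_suml -!big_split /=.
by apply: eq_bigr => i _; apply/matrixP => k l; rewrite !(outerE, mxE); ring.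
Qed.

Lemma span3_addl p q r a d b u v :
  p *: (u *m u^T) + q *: (u *m v^T + v *m u^T) + r *: (v *m v^T)
  + span3 a d 0 b 0 0 u v 0 = span3 (p + a) (r + d) 0 (q + b) 0 0 u v 0.
Proof.
by apply/matrixP => i j; rewrite [LHS]mxE !span3E !(outerE, mxE); ring.
Qed.

(** The hub block of this rank one matrix is what eliminating the leaf [w] subtracts in the Schur
    complement. *)
Lemma span3_rank1 (f c e : R) u v w : f != 0 ->
  f^-1 *: ((c *: u + e *: v + f *: w) *m (c *: u + e *: v + f *: w)^T) =
  span3 (c ^+ 2 / f) (e ^+ 2 / f) f (c * e / f) c e u v w.
Proof.
by move=> f0; apply/matrixP => i j; rewrite span3E !(outerE, mxE); field.
Qed.

Definition basis_col (i : 'I_n) : 'cV[R]_n := delta_mx i 0.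

Lemma basis_colE i j k : basis_col i j k = (j == i)%:R.
Proof. by rewrite mxE ord1 andbT. Qed.

Lemma basis_col_ge0 i : nonneg_mx (basis_col i).
Proof. by move=> j k; rewrite basis_colE ler0n. Qed.

Lemma basis_col_dot i x : ((basis_col i)^T *m x) 0 0 = x i 0.
Proof. by rewrite trmx_delta -rowE mxE. Qed.

Definition quad A x : R := (x^T *m A *m x) 0 0.

Lemma quadD A B x : quad (A + B) x = quad A x + quad B x.
Proof. by rewrite /quad mulmxDr mulmxDl mxE. Qed.

Lemma quadZ c A x : quad (c *: A) x = c * quad A x.
Proof. by rewrite /quad -scalemxAr -scalemxAl mxE. Qed.

Lemma quad_sum (I : Type) (r : seq I) (P : pred I) (F : I -> 'M[R]_n) x :
  quad (\sum_(i <- r | P i) F i) x = \sum_(i <- r | P i) quad (F i) x.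
Proof. by rewrite /quad mulmx_sumr mulmx_suml summxE. Qed.

Lemma quad_outer u v x :
  quad (u *m v^T) x = (u^T *m x) 0 0 * (v^T *m x) 0 0.
Proof.
rewrite /quad mulmxA -mulmxA mxE big_ord1; congr (_ * _).
by rewrite -[x^T *m u]trmxK trmx_mul trmxK mxE.
Qed.

Lemma quad_span3 a d f b c e u v w x :
  let X := (u^T *m x) 0 0 in let Y := (v^T *m x) 0 0 in
  let Z := (w^T *m x) 0 0 in
  quad (span3 a d f b c e u v w) x =
  a * X ^+ 2 + d * Y ^+ 2 + f * Z ^+ 2
  + 2 * (b * X * Y + c * X * Z + e * Y * Z).
Proof. by rewrite /= /span3 !(quadD, quadZ, quad_outer); ring. Qed.

Lemma quad2_discr (p q r : R) :
  (forall s t, 0 <= p * s ^+ 2 + 2 * q * s * t + r * t ^+ 2) ->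
  [/\ 0 <= p, 0 <= r & q ^+ 2 <= p * r].
Proof.
move=> H; have p0 : 0 <= p by have := H 1 0; lra.
have r0 : 0 <= r by have := H 0 1; lra.
split=> //; have [p1|p1] := eqVneq p 0.
  have [->|q1] := eqVneq q 0; first by rewrite expr0n mulr_ge0.
  (* With [p = 0] the form is affine in [s] at [t = 1]; this [s] gives it the value -1. *)
  have := H (- (r + 1) / (2 * q)) 1; rewrite p1.
  have -> : 0 * (- (r + 1) / (2 * q)) ^+ 2 + 2 * q * (- (r + 1) / (2 * q)) * 1
            + r * 1 ^+ 2 = -1 by field.
  by rewrite lerNr oppr0 ler10.
have pp : 0 < p by rewrite lt_def p1.
have := H (- q) p.
have -> : p * (- q) ^+ 2 + 2 * q * - q * p + r * p ^+ 2 = p * (p * r - q ^+ 2).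
  by ring.
by rewrite pmulr_rge0 // subr_ge0.
Qed.

Lemma psd_minor2 A i j : psd_mx A -> A i j ^+ 2 <= A i i * A j j.
Proof.
move=> [symA psdA].
suff [] : [/\ 0 <= A i i, 0 <= A j j & A i j ^+ 2 <= A i i * A j j] by [].
apply: quad2_discr => s t.
have := psdA (s *: basis_col i + t *: basis_col j).
congr (0 <= _).
have bAb k l : ((basis_col k)^T *m A *m basis_col l) 0 0 = A k l.
  by rewrite -mulmxA basis_col_dot -colE mxE.
have Aji : A j i = A i j by rewrite -{1}symA mxE.
have -> (u v : 'cV[R]_n) : (s *: u + t *: v)^T = s *: u^T + t *: v^T.
  by rewrite linearD /= !linearZ.
rewrite !(mulmxDl, mulmxDr) -!(scalemxAl, scalemxAr).
by rewrite !(bAb, mxE) Aji; ring.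
Qed.

Section Hubs.
Variables (A : 'M[R]_n) (a b : 'I_n).
Hypotheses (symA : A^T = A) (ab : a != b).
Hypothesis leaf0 : forall i j,
  i \notin [:: a; b] -> j \notin [:: a; b] -> i != j -> A i j = 0.

Let ea := basis_col a.
Let eb := basis_col b.

(** Distinct leaves are nonadjacent, so each nonzero entry outside the hub block lies in the row or
    column of exactly one leaf. *)
Lemma hub_expansion :
  A = span3 (A a a) (A b b) 0 (A a b) 0 0 ea eb 0
    + \sum_(j | j \notin [:: a; b])
        span3 0 0 (A j j) 0 (A a j) (A b j) ea eb (basis_col j).
Proof.
have symE i j : A i j = A j i by rewrite -{1}symA mxE.
have sumE i j (P : pred 'I_n) (F : 'I_n -> 'M[R]_n) :
  (\sum_(k | P k) F k) i j = \sum_(k | P k) F k i j by rewrite summxE.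
have ba : (b == a) = false by rewrite eq_sym (negbTE ab).
have abF : (a == b) = false by exact: negbTE.
apply/matrixP => i j; rewrite mxE sumE span3E !basis_colE.
under eq_bigr do rewrite span3E !basis_colE.
(* A leaf row with a hub column reduces to its transpose. *)
wlog hubl : i j / (i \in [:: a; b]) || (j \notin [:: a; b]).
  move=> H; have [ih|ih] := boolP ((i \in [:: a; b]) || (j \notin [:: a; b])).
    exact: H.
  rewrite negb_or negbK in ih; case/andP: ih => _ ih.
  rewrite symE H ?ih //; congr (_ + _); first by rewrite !mxE; ring.
  by apply: eq_bigr => k _; ring.
have [jh|jl] := boolP (j \in [:: a; b]).
  rewrite jh orbF in hubl; rewrite big1 => [|k].
    move: hubl jh; rewrite !inE => /orP[] /eqP-> /orP[] /eqP->;
    by rewrite ?eqxx ?ba ?abF ?[A b a]symE !mxE /=; ring.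
  move: hubl jh; rewrite !inE negb_or => ih jh /andP[/negbTE ka /negbTE kb].
  have -> : (i == k) = false by case/orP: ih => /eqP->; rewrite eq_sym.
  have -> : (j == k) = false by case/orP: jh => /eqP->; rewrite eq_sym.
  by rewrite /=; ring.
have := jl; rewrite !inE negb_or => /andP[/negbTE ja /negbTE jb].
rewrite (bigD1 j) //= big1 => [|k /andP[_]].
  rewrite eqxx ja jb !mxE.
  have [ih|il] := boolP (i \in [:: a; b]).
    have ji : (i == j) = false by apply: contraNF jl => /eqP <-.
    rewrite ji; move: ih; rewrite !inE => /orP[] /eqP->.
      by rewrite eqxx abF; rewrite /=; ring.
    by rewrite eqxx ba; rewrite /=; ring.
  have := il; rewrite !inE negb_or => /andP[/negbTE -> /negbTE ->].
  have [->|ij] := eqVneq i j; first by rewrite /=; ring.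
  by rewrite leaf0 //; rewrite /=; ring.
rewrite eq_sym => /negbTE jk; rewrite ja jb jk.
by rewrite /=; ring.
Qed.

Let leaf j := j \notin [:: a; b].
Let s11 := A a a - \sum_(j | leaf j) A a j ^+ 2 / A j j.
Let s12 := A a b - \sum_(j | leaf j) A a j * A b j / A j j.
Let s22 := A b b - \sum_(j | leaf j) A b j ^+ 2 / A j j.

Lemma hub_schur_psd : psd_mx A ->
  [/\ 0 <= s11, 0 <= s22 & s12 ^+ 2 <= s11 * s22].
Proof.
move=> [_ psdA]; apply: quad2_discr => s t.
(* With hub coordinates [s] and [t], the leaf coordinates are the critical point of the form, whose
   value there is the Schur complement form. *)
pose x : 'cV[R]_n := \col_i (if i == a then s else if i == b then t
                             else - ((s * A a i + t * A b i) / A i i)).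
have := psdA x; rewrite -/(quad A x); congr (0 <= _).
have xa : x a 0 = s by rewrite mxE eqxx.
have xb : x b 0 = t by rewrite mxE eq_sym (negbTE ab) eqxx.
have xl j : leaf j -> x j 0 = - ((s * A a j + t * A b j) / A j j).
  by rewrite /leaf !inE negb_or mxE => /andP[/negbTE-> /negbTE->].
rewrite {1}hub_expansion quadD quad_sum quad_span3 !basis_col_dot xa xb.
rewrite (eq_bigr (fun j => - s ^+ 2 * (A a j ^+ 2 / A j j)
   + - (2 * s * t) * (A a j * A b j / A j j)
   + - t ^+ 2 * (A b j ^+ 2 / A j j))).
  by rewrite !big_split /= -!mulr_sumr /s11 /s12 /s22; ring.
move=> j lj; rewrite quad_span3 !basis_col_dot xa xb xl //.
(* The inverse of 0 is 0, so both sides vanish when the diagonal entry does. *)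
have [->|d0] := eqVneq (A j j) 0; first by rewrite invr0; ring.
by field.
Qed.

Lemma cp_hubs : doubly_nonnegative A -> completely_positive A.
Proof.
move=> [A0 psdA]; have [s110 s220 detS] := hub_schur_psd psdA.
have ea0 : nonneg_mx ea by exact: basis_col_ge0.
have eb0 : nonneg_mx eb by exact: basis_col_ge0.
have diag0 i j : A j j = 0 -> A i j = 0.
  move=> Ajj; apply/eqP; rewrite -sqrf_eq0 eq_le sqr_ge0 andbT.
  by have := psd_minor2 i j psdA; rewrite Ajj mulr0.
have [s120|s12n] := leP 0 s12.
  have -> : A = (s11 *: (ea *m ea^T) + s12 *: (ea *m eb^T + eb *m ea^T)
                 + s22 *: (eb *m eb^T)) + \sum_(j | leaf j) (A j j)^-1 *:
     (let v := A a j *: ea + A b j *: eb + A j j *: basis_col j in v *m v^T).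
    rewrite (eq_bigr (fun j => span3 (A a j ^+ 2 / A j j) (A b j ^+ 2 / A j j)
      (A j j) (A a j * A b j / A j j) (A a j) (A b j) ea eb (basis_col j))).
      by rewrite span3_sum {1}hub_expansion addrA span3_addl /s11 /s12 /s22 !subrK.
    (* A leaf with zero diagonal entry has zero hub entries too, so its term is 0. *)
    move=> j _ /=; have [d0|d0] := eqVneq (A j j) 0; last exact: span3_rank1.
    rewrite d0 (diag0 a j d0) (diag0 b j d0) invr0 scale0r.
    by rewrite !(mulr0, mulr1) /span3 !scale0r !addr0.
  apply: cpD; first exact: cp_order2.
  apply: cp_sum => j _; apply: cp_outer; first by rewrite invr_ge0.
  by move=> i k; rewrite !mxE !addr_ge0 ?mulr_ge0.
pose c j := A a j * A b j / A j j.
pose C := \sum_(j | leaf j) c j.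
have c0 j : 0 <= c j by rewrite divr_ge0 ?mulr_ge0.
have C0 : 0 < C by have := A0 a b; rewrite /s12 -/C in s12n *; lra.
pose mu j := c j / C.
have mu0 j : 0 <= mu j by rewrite divr_ge0 // ltW.
have muS s : \sum_(j | leaf j) mu j * s = s.
  by rewrite -!mulr_suml divff ?mul1r // gt_eqF.
have -> : A = \sum_(j | leaf j) span3 (A a j ^+ 2 / A j j + mu j * s11)
   (A b j ^+ 2 / A j j + mu j * s22) (A j j) (c j + mu j * s12)
   (A a j) (A b j) ea eb (basis_col j).
  rewrite span3_sum {1}hub_expansion !big_split /= !muS.
  by rewrite /s11 /s12 /s22 !subrKC.
apply: cp_sum => j _; set d := A j j.
have d0 : 0 <= d by exact: A0.
have ba0 : 0 <= A a j by exact: A0.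
have bb0 : 0 <= A b j by exact: A0.
have q11 : 0 <= A a j ^+ 2 / d by rewrite divr_ge0 ?sqr_ge0.
have q22 : 0 <= A b j ^+ 2 / d by rewrite divr_ge0 ?sqr_ge0.
have m11 : 0 <= mu j * s11 by rewrite mulr_ge0.
have m22 : 0 <= mu j * s22 by rewrite mulr_ge0.
have cE : (c j) ^+ 2 = (A a j ^+ 2 / d) * (A b j ^+ 2 / d) by rewrite /c -/d; ring.
have mdet : (mu j * s12) ^+ 2 <= (mu j * s11) * (mu j * s22).
  have -> : (mu j * s11) * (mu j * s22) = mu j ^+ 2 * (s11 * s22) by ring.
  by rewrite exprMn ler_wpM2l ?sqr_ge0.
have wd (i : 'I_n) : A i j ^+ 2 / d * d = A i j ^+ 2.
  have [d1|d1] := eqVneq d 0; last by rewrite divfK.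
  by rewrite d1 (diag0 i j d1); ring.
have cd : c j * d = A a j * A b j.
  rewrite /c -/d; have [d1|d1] := eqVneq d 0; last by rewrite divfK.
  by rewrite d1 (diag0 a j d1); ring.
apply: cp_order3 => //; try exact: basis_col_ge0; try exact: addr_ge0.
(* Weights proportional to [c j] are chosen for this identity, which keeps the hub entry
   nonnegative. *)
- have -> : c j + mu j * s12 = mu j * A a b.
    have -> : s12 = A a b - C by [].
    by rewrite /mu; field; rewrite gt_eqF.
  by rewrite mulr_ge0.
(* As [s12 < 0], the mixed term of the expanded square has the favourable sign. *)
- have x1 : 0 <= c j * (mu j * - s12).
    by apply: mulr_ge0 => //; apply: mulr_ge0 => //; rewrite oppr_ge0 ltW.
  have x2 : 0 <= (A a j ^+ 2 / d) * (mu j * s22) by exact: mulr_ge0.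
  have x3 : 0 <= (mu j * s11) * (A b j ^+ 2 / d) by exact: mulr_ge0.
  lra.
- by rewrite mulrDl wd lerDl mulr_ge0.
- by rewrite mulrDl wd lerDl mulr_ge0.
(* Eliminating the leaf again leaves [mu j] times the Schur complement. *)
- suff -> : (A a j ^+ 2 / d + mu j * s11) * (A b j ^+ 2 / d + mu j * s22) * d
      + 2 * (c j + mu j * s12) * A a j * A b j
      - (A a j ^+ 2 / d + mu j * s11) * A b j ^+ 2
      - (A b j ^+ 2 / d + mu j * s22) * A a j ^+ 2
      - d * (c j + mu j * s12) ^+ 2
      = d * ((mu j * s11) * (mu j * s22) - (mu j * s12) ^+ 2).
    by rewrite mulr_ge0 // subr_ge0.
  have [d1|d1] := eqVneq d 0; last by rewrite /c -/d; field.
  by rewrite d1 (diag0 a j d1) (diag0 b j d1); ring.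
Qed.

End Hubs.
End TwoHubs.

(** * Graphs containing a five-cycle, and the Horn form *)

Section FiveCycle.
Local Open Scope ring_scope.

Variable R : realType.

Definition cyc5 : rel 'I_5 := fun i j =>
  (j == i.+1 %% 5 :> nat)%N || (i == j.+1 %% 5 :> nat)%N.

Lemma cyc5_sym : symmetric cyc5.
Proof. by move=> i j; rewrite /cyc5 orbC. Qed.

(* The ratio 7/4 lies between 2 cos (pi/5), above which the matrix is positive
   semidefinite, and 2, below which its inner product with the Horn matrix is
   negative. *)
Definition cycle_mx : 'M[R]_5 :=
  \matrix_(i, j) (if i == j then 7 else if cyc5 i j then 4 else 0).

Definition horn_mx : 'M[R]_5 :=
  \matrix_(i, j) (if cyc5 i j then -1 else 1).

Lemma quadE n (A : 'M[R]_n) x :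
  quad A x = \sum_i \sum_j x i 0 * A i j * x j 0.
Proof.
rewrite /quad mxE exchange_big; apply: eq_bigr => j _ /=.
by rewrite mxE mulr_suml; apply: eq_bigr => i _; rewrite mxE.
Qed.

Lemma sum5 (F : 'I_5 -> R) : \sum_i F i =
  F 0 + F 1 + F (inord 2) + F (inord 3) + F (inord 4).
Proof.
rewrite !big_ord_recl big_ord0 addr0 !addrA.
by do !congr (_ + _); congr F; apply: val_inj; rewrite /= ?inordK.
Qed.

Lemma cycle_mx_psd x : 0 <= quad cycle_mx x.
Proof.
rewrite quadE !sum5 !mxE /cyc5 -!val_eqE /= !inordK //=.
move: (x 0 0) (x 1 0) (x (inord 2) 0) (x (inord 3) 0) (x (inord 4) 0).
move=> y0 y1 y2 y3 y4.
(* The squares of the LDL^T decomposition. *)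
have sq (c y : R) : 0 <= c -> 0 <= c * y ^+ 2 by move=> ?; rewrite mulr_ge0 ?sqr_ge0.
have h0 := sq 7 (y0 + 4 / 7 * y1 + 4 / 7 * y4) ltac:(lra).
have h1 := sq (33 / 7) (y1 + 28 / 33 * y2 - 16 / 33 * y4) ltac:(lra).
have h2 := sq (119 / 33) (y2 + 132 / 119 * y3 + 64 / 119 * y4) ltac:(lra).
have h3 := sq (305 / 119) (y3 + 44 / 61 * y4) ltac:(lra).
have h4 := sq (75 / 61) y4 ltac:(lra).
lra.
Qed.

(* When y4 >= y3 the form is
   (y0 - y1 + y2 + y3 - y4)^2 + 4 y1 y3 + 4 y2 (y4 - y3), and symmetrically. *)
Lemma horn_mx_copositive x : nonneg_mx x -> 0 <= quad horn_mx x.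
Proof.
move=> x0; rewrite quadE !sum5 !mxE /cyc5 /= !inordK //=.
move: (x 0 0) (x0 0 0) (x 1 0) (x0 1 0) (x (inord 2) 0) (x0 (inord 2) 0)
  (x (inord 3) 0) (x0 (inord 3) 0) (x (inord 4) 0) (x0 (inord 4) 0).
move=> y0 p0 y1 p1 y2 p2 y3 p3 y4 p4.
have [y34|/ltW y43] := leP y3 y4.
- have h1 := sqr_ge0 (y0 - y1 + y2 + y3 - y4).
  have h2 : 0 <= y1 * y3 by rewrite mulr_ge0.
  have h3 : 0 <= y2 * (y4 - y3) by rewrite mulr_ge0 ?subr_ge0.
  lra.
- have h1 := sqr_ge0 (y0 - y1 + y2 - y3 + y4).
  have h2 : 0 <= y1 * y4 by rewrite mulr_ge0.
  have h3 : 0 <= y0 * (y3 - y4) by rewrite mulr_ge0 ?subr_ge0.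
  lra.
Qed.

Lemma five_cycle_not_CP (G : sgraph) (f : 'I_5 -> vertex G) :
  injective f -> (forall i j, cyc5 i j -> edge (f i) (f j)) ->
  ~ CP_graph R G.
Proof.
move=> injf fE cpG.
pose N := #|vertex G|.
pose g i : 'I_N := enum_rank (f i).
have injg : injective g by move=> i j /enum_rank_inj /injf.
pose e (i j : 'I_N) := edge (enum_val i) (enum_val j).
have ge l m : cyc5 l m -> e (g l) (g m) by rewrite /e !enum_rankK; exact: fE.
have esym i j : e i j = e j i by exact: edge_sym.
(* [K] is [cycle_mx] placed at the indices [g l], zero elsewhere; [P] has the pattern of [G] and a
   dominant diagonal. *)
pose U : 'M[R]_(N, 5) := \matrix_(i, l) (i == g l)%:R.
pose P : 'M[R]_N := \matrix_(i, j) (if i == j then N%:R else (e i j)%:R).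
pose K : 'M[R]_N := U *m cycle_mx *m U^T.
(* The inner product of [horn_mx] with [cycle_mx] is 35 - 40 = -5, and [P] adds at most 5 N + 10, so
   the factor N + 4 brings the total to at most -10. *)
pose A := (N%:R + 4) *: K + P.
have KE i j : K i j =
    \sum_m \sum_l (i == g l)%:R * cycle_mx l m * (j == g m)%:R.
  rewrite mxE; apply: eq_bigr => m _; rewrite mxE mulr_suml.
  by apply: eq_bigr => l _; rewrite !mxE.
have C0 l m : 0 <= cycle_mx l m by rewrite mxE; do 2 case: ifP => _ //.
have K0 i j : 0 <= K i j.
  by rewrite KE; do 2 apply: sumr_ge0 => ? _; rewrite !mulr_ge0 ?ler0n.
have P0 i j : 0 <= P i j by rewrite mxE; case: ifP => _; rewrite ler0n.
have N0 : 0 <= N%:R + 4 :> R by rewrite addr_ge0 ?ler0n.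
have A0 : nonneg_mx A by move=> i j; rewrite 2!mxE addr_ge0 ?mulr_ge0.
have Asym : A^T = A.
  have Ks : K^T = K.
    rewrite /K !trmx_mul trmxK mulmxA; congr (_ *m _ *m _).
    by apply/matrixP => l m; rewrite !mxE eq_sym cyc5_sym.
  rewrite /A linearD linearZ /= Ks; congr (_ + _).
  by apply/matrixP => i j; rewrite !mxE eq_sym esym.
have Apsd : psd_mx A.
  split=> // x; rewrite -/(quad A x) quadD quadZ addr_ge0 ?mulr_ge0 //.
    have -> : quad K x = quad cycle_mx (U^T *m x).
      by rewrite /quad /K trmx_mul trmxK !mulmxA.
    exact: cycle_mx_psd.
  (* The diagonal N is spread over all ordered pairs, each of which then gives half a square or half
     a sum of squares. *)
  have -> : quad P x = \sum_i \sum_j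
      ((x i 0 ^+ 2 + x j 0 ^+ 2) / 2 + (e i j)%:R * x i 0 * x j 0).
    have -> : quad P x =
        \sum_i (N%:R * x i 0 ^+ 2 + \sum_j (e i j)%:R * x i 0 * x j 0).
      rewrite quadE; apply: eq_bigr => i _.
      rewrite (bigD1 i) //= [in RHS](bigD1 i) //= mxE eqxx /e edge_irr.
      rewrite addrA; congr (_ + _); first by rewrite /=; ring.
      by apply: eq_bigr => j ji; rewrite mxE eq_sym (negbTE ji); ring.
    under [RHS]eq_bigr do rewrite big_split.
    rewrite !big_split /=; congr (_ + _).
    transitivity (\sum_(i < N) \sum_(j < N) (x i 0 ^+ 2 / 2)
                  + \sum_(i < N) \sum_(j < N) (x j 0 ^+ 2 / 2)).
      rewrite [X in _ + X]exchange_big -big_split; apply: eq_bigr => i _ /=.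
      by rewrite sumr_const card_ord -mulr_natl; field.
    rewrite -big_split; apply: eq_bigr => i _; rewrite -big_split.
    by apply: eq_bigr => j _; rewrite mulrDl.
  apply: sumr_ge0 => i _; apply: sumr_ge0 => j _; case: (e i j) => /=.
    by have := sqr_ge0 (x i 0 + x j 0); lra.
  by have := sqr_ge0 (x i 0); have := sqr_ge0 (x j 0); lra.
have Aedge i j : mx_rel A i j = e i j.
  rewrite /mx_rel; have [->|ij] := eqVneq i j; first by rewrite /e edge_irr.
  rewrite /= 2!mxE [P i j]mxE (negbTE ij).
  have [eij|neij] := boolP (e i j).
    by rewrite gt_eqF // ltr_wpDl ?mulr_ge0.
  suff -> : K i j = 0 by rewrite mulr0 addr0 eqxx.
  rewrite KE big1 // => m _; rewrite big1 // => l _.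
  have [il|] := eqVneq i (g l); last by rewrite !mul0r.
  have [jm|] := eqVneq j (g m); last by rewrite mulr0.
  rewrite mxE; case: ifP => [/eqP lm|_]; first by rewrite il jm lm eqxx in ij.
  case: ifP => [lm|_]; last by rewrite mulr0 mul0r.
  by rewrite il jm ge in neij.
have [m [B [B0 AB]]] : completely_positive A.
  apply: cpG => //; exists Asym, enum_val; first exact: enum_val_bij.
  by move=> i j; rewrite /= Aedge.
pose S := \sum_l \sum_k horn_mx l k * A (g l) (g k).
have S0 : 0 <= S.
  (* Each column of [B], restricted to the cycle, is a nonnegative argument of the Horn form. *)
  have -> : S = \sum_t quad horn_mx (\col_l B (g l) t).
    under [RHS]eq_bigr do rewrite quadE.
    rewrite [RHS]exchange_big; apply: eq_bigr => l _.
    rewrite [RHS]exchange_big; apply: eq_bigr => k _.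
    rewrite AB [(B *m _) _ _]mxE mulr_sumr; apply: eq_bigr => t _.
    by rewrite [B^T _ _]mxE ![(\col_ _ _) _ _]mxE; ring.
  apply: sumr_ge0 => t _; apply: horn_mx_copositive => l k.
  by rewrite mxE.
have Kg l k : K (g l) (g k) = cycle_mx l k.
  rewrite KE (bigD1 k) //= [X in _ + X]big1 ?addr0 => [|k' kk'].
    rewrite (bigD1 l) //= [X in _ + X]big1 ?addr0 => [|l' ll'].
      by rewrite !eqxx /=; ring.
    by rewrite (inj_eq injg) eq_sym (negbTE ll') !mul0r.
  rewrite big1 // => l' _.
  by rewrite [g k == _](inj_eq injg) [k == _]eq_sym (negbTE kk') mulr0.
(* On cycle edges the Horn sign is -1, so the entry of [P] is dropped; at the other off-diagonal
   places it is at most 1. *)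
have HA l k : horn_mx l k * A (g l) (g k) <=
    horn_mx l k * ((N%:R + 4) * cycle_mx l k)
    + (if l == k then N%:R else if cyc5 l k then 0 else 1).
  rewrite [A _ _]mxE [X in X + _]mxE Kg mulrDr lerD2l.
  have [<-|lk] := eqVneq l k.
    by rewrite !mxE eqxx; have := ler0n R N; case: ifP => _; lra.
  rewrite mxE; case: ifP => _; first by rewrite mulN1r oppr_le0.
  by rewrite mul1r mxE (inj_eq injg) (negbTE lk) lern1 leq_b1.
have := le_trans S0 (ler_sum _ (fun l _ => ler_sum _ (fun k _ => HA l k))).
rewrite !sum5 ![horn_mx _ _]mxE ![cycle_mx _ _]mxE /cyc5 -!val_eqE /= !inordK //=.
have : 0 <= N%:R :> R by exact: ler0n.
move: (N%:R : R) => t; lra.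
Qed.

End FiveCycle.

(** * Joins of a complete graph and an empty graph *)

Section TGraph.

Variable R : realType.

(** Three vertices [v0], [v1], [v3] of the complete part and [v2] of the empty part form the path
    [v0 v1 v2 v3]. A second vertex of the empty part, or else a fourth of the complete part, closes
    it to a 5-cycle. *)
Lemma join_complete_empty_not_CP (k q : nat) : 2 < k -> 0 < q -> 4 < k + q ->
  ~ CP_graph R (join_graph (complete_graph k) (empty_graph q)).
Proof.
case: k => [|[|[|k]]] // _; case: q => [|q] // _ kq.
set G := join_graph _ _.
pose hub (i : nat) (ik : i < k.+3) : vertex G := inl (Ordinal ik).
pose v0 := hub 0 isT; pose v1 := hub 1 isT; pose v3 := hub 2 isT.
pose v2 : vertex G := inr ord0.
suff [v4 [inj4 e34 e40]] : exists v4 : vertex G,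
    [/\ v4 \notin [:: v0; v1; v2; v3], edge v3 v4 & edge v4 v0].
  pose f (i : 'I_5) := nth v0 [:: v0; v1; v2; v3; v4] i.
  apply: (@five_cycle_not_CP R _ f).
    have Uf : uniq [:: v0; v1; v2; v3; v4].
      by rewrite /= !inE; move: inj4; rewrite !inE !negb_or ![v4 == _]eq_sym;
         case/and4P=> -> -> -> ->.
    move=> i j /eqP; rewrite /f nth_uniq // => /eqP; exact: val_inj.
  suff H (i j : 'I_5) : (j == i.+1 %% 5 :> nat) -> edge (f i) (f j).
    by move=> i j /orP[/H//|/H]; rewrite edge_sym.
  by rewrite /f => /eqP ->; case: i => [[|[|[|[|[|]]]]]].
case: q kq @G @hub @v0 @v1 @v2 @v3 => [|q] kq G hub v0 v1 v2 v3.
  case: k kq @G @hub @v0 @v1 @v2 @v3 => [//|k] kq G hub v0 v1 v2 v3.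
  exists (inl (@Ordinal k.+4 3 isT)).
  by split.
by exists (inr (@Ordinal q.+2 1 isT)); split.
Qed.

(** For [k = 2] the hubs are the complete part; for [k = 1] a vertex of the empty part serves as the
    second hub. *)
Lemma join_complete_empty_CP (k q : nat) : 0 < k <= 2 -> 0 < q ->
  CP_graph R (join_graph (complete_graph k) (empty_graph q)).
Proof.
move=> /andP[k0 k2] q0 n A [symA [f [g fK gK] fE]] dnn.
have hubsP a b : a != b ->
    (forall i, i \notin [:: a; b] -> exists y : 'I_q, f i = inr y) ->
    completely_positive A.
  move=> ab leafP; apply: (@cp_hubs _ _ _ a b) => // i j li lj ij.
  have [y fi] := leafP _ li; have [z fj] := leafP _ lj.
  have := fE i j; rewrite fi fj /= /mx_rel ij /=.
  by move/esym/negbFE/eqP.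
case: k k0 k2 f g fK gK fE hubsP => [|[|[|k]]] // _ _ f g fK gK fE hubsP.
- apply: (hubsP (g (inl ord0)) (g (inr (Ordinal q0)))).
    by rewrite (inj_eq (can_inj gK)).
  move=> i; rewrite !inE negb_or => /andP[ia _].
  case fi: (f i) => [x|y]; last by exists y.
  by rewrite -[i]fK fi (ord1 x) eqxx in ia.
- apply: (hubsP (g (inl ord0)) (g (inl ord_max))).
    by rewrite (inj_eq (can_inj gK)).
  move=> i; rewrite !inE negb_or => /andP[ia ib].
  case fi: (f i) => [x|y]; last by exists y.
  rewrite -[i]fK fi !(inj_eq (can_inj gK)) in ia ib.
  by case: x {fi} ia ib => [[|[|]]].
Qed.

End TGraph.

(* The pair (4, 3) is excluded: T_{4,3} = K_4 is completely positive, since every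
   doubly nonnegative matrix of order at most 4 is (Maxfield and Minc). *)
Theorem mainTheorem3 (R : realType) (n k : nat) (hk : 0 < k) (hkn : k < n)
    (hnk : (n, k) <> (4, 3)) :
  CP_graph R (T_graph n k) <-> k <= 2.
Proof.
have q0 : 0 < n - k by rewrite subn_gt0.
split=> [cpT|k2]; last by apply: join_complete_empty_CP => //; rewrite hk.
rewrite leqNgt; apply/negP => k2.
apply: join_complete_empty_not_CP cpT => //.
(* If [n <= 4], then [2 < k < n] leaves only the excluded pair. *)
rewrite (subnKC (ltnW hkn)) ltnNge; apply/negP => n4.
apply: hnk; congr (_, _); apply/eqP; rewrite eqn_leq.
  by rewrite n4 (leq_ltn_trans k2 hkn).
by rewrite k2 -ltnS (leq_trans hkn n4).
Qed.
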